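(* Let $\mathbb{F}$ be a field with $|\mathbb{F}|\leq 3$. Every matrix in the commutator subgroup $SL_2(\mathbb{F})'$ is a product of at most $|\mathbb{F}|-1$ commutators of $\mathcal{U}_2$-matrices. The upper bound $|\mathbb{F}|-1$ cannot be further reduced. Moreover, $SL_2(\mathbb{F})'$ is a proper subgroup of $SL_2(\mathbb{F})$.
   Context: $SL_2(\mathbb{F})$ is the group of $2\times 2$ matrices over $\mathbb F$ with determinant $1$; $G'$ denotes the commutator (derived) subgroup of a group $G$, i.e. the subgroup generated by all $xyx^{-1}y^{-1}$ with $x,y\in G$. A matrix $X\in M_2(\mathbb{F})$ is a $\mathcal{U}_2$-matrix (unipotent matrix of index $2$) if $(X-I_2)^2=0_2$ and $X\neq I_2$. For invertible $X,Y$, $[X,Y]:=XYX^{-1}Y^{-1}$. A commutator of $\mathcal{U}_2$-matrices is a matrix of the form $[X,Y]$ where both $X,Y\in M_2(\mathbb{F})$ are $\mathcal{U}_2$-matrices. A ''product of at most $r$'' commutators means a product of $s$ commutators for some $1\le s\le r$. *)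

(* Defs.v *)
From HB Require Import structures.
From mathcomp Require Import all_boot all_order all_algebra all_fingroup all_solvable.

Set Implicit Arguments.
Unset Strict Implicit.
Unset Printing Implicit Defensive.

Import GroupScope GRing.Theory.
Local Open Scope ring_scope.

Definition SL2 (F : finFieldType) : {set {'GL_2[F]}} :=
  [set g : {'GL_2[F]} | \det (GLval g) == 1].

Lemma SL2_group_set (F : finFieldType) : group_set (SL2 F).
Proof.
apply/group_setP; split=> [|g h]; first by rewrite inE GL_1E det1.
by rewrite !inE GL_MxE det_mulmx => /eqP-> /eqP->; rewrite mulr1.
Qed.

Canonical SL2_group (F : finFieldType) := Group (SL2_group_set F).

Definition U2_matrix (F : fieldType) (X : 'M[F]_2) : Prop :=
  (X - 1%:M) ^+ 2 = 0 /\ X <> 1%:M.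

(* This is X Y X^-1 Y^-1, unlike MathComp's [~ X, Y] = X^-1 Y^-1 X Y.
   invmx is the genuine inverse on U_2-matrices, which are all invertible. *)
Definition mx_commutator (F : fieldType) (X Y : 'M[F]_2) : 'M[F]_2 :=
  X *m Y *m invmx X *m invmx Y.

Definition U2_commutator (F : fieldType) (C : 'M[F]_2) : Prop :=
  exists X Y : 'M[F]_2,
    [/\ U2_matrix X, U2_matrix Y & C = mx_commutator X Y].

(* The number of factors is at least 1: the empty product is not allowed. *)
Definition prod_at_most_U2_commutators
    (F : fieldType) (r : nat) (A : 'M[F]_2) : Prop :=
  exists s : seq 'M[F]_2,
    [/\ (1 <= size s <= r)%N,
        (forall C, C \in s -> U2_commutator C)
      & A = \prod_(C <- s) C].

(* Main.v *)
(* For |F| <= 3 the function theta(a,b,c,d) = (1-c^2)bd + c(a+d-3), the reduction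
   mod 2 or 3 of the classical character of SL_2(Z) onto Z/12, is an additive
   character of SL_2(F). It therefore vanishes on SL_2(F)', and its value 1 at
   (1,1;0,1) shows that SL_2(F)' is proper. A zero of theta in SL_2(F) is either
   1, -1, or a matrix with c <> 0 and trace 3, which over any field is the
   commutator of the U_2-matrices (1,1/c;0,1) and (1-d,-d^2/c;c,1+d). In
   characteristic 3, -1 = J^2 with J = (0,-1;1,0) of trace 0 = 3, but -1 is not
   [X,Y]: from XY = -YX and Y^2 = 2Y-1 one gets 4YX = 0. *)
Require Import Defs.
From HB Require Import structures.
From mathcomp Require Import all_boot all_order all_algebra all_fingroup all_solvable.
From mathcomp Require Import finfield ring.

Set Implicit Arguments.
Unset Strict Implicit.
Unset Printing Implicit Defensive.

Import GRing.Theory.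

(** * Explicit 2 by 2 matrices *)

Section Matrix2.
Local Open Scope ring_scope.

Definition mx2 (R : Type) (a b c d : R) : 'M[R]_2 :=
  \matrix_(i, j) if i == 0 then (if j == 0 then a else b)
                 else (if j == 0 then c else d).

Lemma ord2P (i : 'I_2) : i = 0 \/ i = 1.
Proof. by case: i => -[|[|]] //= h; [left|right]; apply: val_inj. Qed.

Lemma matrix2P (R : Type) (A B : 'M[R]_2) :
  [/\ A 0 0 = B 0 0, A 0 1 = B 0 1, A 1 0 = B 1 0 & A 1 1 = B 1 1] -> A = B.
Proof.
by case=> e00 e01 e10 e11; apply/matrixP=> i j;
  case: (ord2P i) => ->; case: (ord2P j) => ->.
Qed.

Lemma mx2_eta (R : Type) (A : 'M[R]_2) :
  A = mx2 (A 0 0) (A 0 1) (A 1 0) (A 1 1).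
Proof. by apply: matrix2P; split; rewrite mxE. Qed.

Lemma mx2_scalar (R : pzRingType) (a : R) : a%:M = mx2 a 0 0 a.
Proof. by apply: matrix2P; split; rewrite !mxE. Qed.

Lemma mx2_mul (R : pzRingType) (a b c d a' b' c' d' : R) :
  mx2 a b c d *m mx2 a' b' c' d' =
  mx2 (a * a' + b * c') (a * b' + b * d') (c * a' + d * c') (c * b' + d * d').
Proof.
by apply: matrix2P; split; rewrite !mxE !big_ord_recl big_ord0 !mxE addr0.
Qed.

Lemma mx2_sub (R : pzRingType) (a b c d a' b' c' d' : R) :
  mx2 a b c d - mx2 a' b' c' d' = mx2 (a - a') (b - b') (c - c') (d - d').
Proof. by apply: matrix2P; split; rewrite !mxE. Qed.

Lemma det_mx2 (R : comPzRingType) (a b c d : R) :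
  \det (mx2 a b c d) = a * d - b * c.
Proof.
rewrite (expand_det_row _ 0) !big_ord_recl big_ord0 /cofactor !det_mx11 !mxE.
by rewrite /= expr0 expr1 mul1r mulN1r mulrN addr0.
Qed.

Lemma invmx_eq (R : comUnitRingType) (n : nat) (A B : 'M[R]_n) :
  A *m B = 1%:M -> invmx A = B.
Proof.
move=> AB; have [uA _] := mulmx1_unit AB.
by rewrite -[B](mulKmx uA) AB mulmx1.
Qed.

End Matrix2.

(** * Matrices [1 + N] with [N] square-zero, and their commutators *)

Section U2.
Local Open Scope ring_scope.
Variable F : fieldType.

(** The part [N = (x,y;z,-x)] has trace 0 and determinant 0, so [N^2 = 0] by Cayley-Hamilton. *)
Lemma U2_mx2 (x y z : F) : x ^+ 2 = - (y * z) ->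
  [|| x != 0, y != 0 | z != 0] -> U2_matrix (mx2 (1 + x) y z (1 - x)).
Proof.
move=> sq0 nz; split.
  rewrite expr2 -mulmxE mx2_scalar mx2_sub mx2_mul.
  by apply: matrix2P; split; rewrite !mxE /=; ring: sq0.
move=> /matrixP e; move: (e 0 0) (e 0 1) (e 1 0) nz; rewrite !mxE /= => /eqP.
by rewrite mulr1n -subr_eq0 addrC addKr => /eqP -> -> ->; rewrite eqxx.
Qed.

(** Since [N^2 = 0], the inverse of [1 + N] is [1 - N]. *)
Lemma invmx_U2_mx2 (x y z : F) : x ^+ 2 = - (y * z) ->
  invmx (mx2 (1 + x) y z (1 - x)) = mx2 (1 - x) (- y) (- z) (1 + x).
Proof.
move=> sq0; apply: invmx_eq; rewrite mx2_mul mx2_scalar.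
by apply: matrix2P; split; rewrite !mxE /=; ring: sq0.
Qed.

Lemma trace3_U2_commutator (a b c d : F) :
  c != 0 -> a * d - b * c = 1 -> a + d = 3%:R ->
  U2_commutator (mx2 a b c d).
Proof.
move=> c0 det tr.
(* Trace and determinant eliminate [a] and [b], leaving identities in [c] and [d] that need only [c]
   inverted. *)
have ea : a = 3%:R - d by rewrite -tr addrK.
have {det}-> : b = ((3%:R - d) * d - 1) / c by rewrite -ea -det opprB addrC subrK mulfK.
rewrite {}ea.
have X0 : 0 ^+ 2 = - (c^-1 * 0) :> F by ring.
have Y0 : (- d) ^+ 2 = - ((- d ^+ 2 / c) * c) by field.
exists (mx2 (1 + 0) c^-1 0 (1 - 0)), (mx2 (1 + - d) (- d ^+ 2 / c) c (1 - - d)).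
split; [by apply: U2_mx2; rewrite ?invr_eq0 ?c0 ?orbT..|].
rewrite /mx_commutator !invmx_U2_mx2 // !mx2_mul.
by apply: matrix2P; split; rewrite !mxE /=; field.
Qed.

(** [[X, X] = 1] for a transvection [X]; this replaces the empty product, which is not allowed. *)
Lemma U2_commutator1 : U2_commutator (1%:M : 'M[F]_2).
Proof.
have X0 : 0 ^+ 2 = - (1 * 0) :> F by ring.
exists (mx2 (1 + 0) 1 0 (1 - 0)), (mx2 (1 + 0) 1 0 (1 - 0)).
split; [by apply: U2_mx2; rewrite ?oner_eq0 ?orbT..|].
rewrite /mx_commutator !invmx_U2_mx2 // !mx2_mul mx2_scalar.
by apply: matrix2P; split; rewrite !mxE /=; ring.
Qed.

Lemma U2_unit (X : 'M[F]_2) : U2_matrix X -> X \in unitmx.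
Proof.
case; set N := X - 1%:M => N2 _.
have /mulmx1_unit[] // : X *m (1 - N) = 1%:M.
rewrite -[X](subrK 1%:M) -/N mulmxE mulrBr mulr1 mulrDl -expr2 N2 mul1r add0r.
by rewrite addrAC subrr add0r.
Qed.

Lemma opp1_not_U2_commutator : 2%:R != 0 :> F ->
  ~ U2_commutator (- 1%:M : 'M[F]_2).
Proof.
move=> two [X] [Y] [UX UY]; rewrite /mx_commutator => eC.
have [uX uY] := (U2_unit UX, U2_unit UY).
have {eC} XY : X * Y = - (Y * X).
  have := congr1 (fun C => C *m Y *m X) eC.
  by rewrite !mulmxKV // !mulNmx mul1mx -!mulmxE.
have Y2 : Y * Y = Y + Y - 1.
  case: UY; rewrite expr2 mulrBr mulrBl mulr1 mul1r => /eqP.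
  by rewrite subr_eq0 subr_eq => /eqP -> _; rewrite addrAC.
(* Passing [X] over [Y] twice cancels the signs, so [X] commutes with [Y^2 = 2Y - 1]. Hence
   [2XY = 2YX], and anticommutation turns this into [4YX = 0], although [YX] is invertible. *)
have : X * Y * Y = Y * (Y * X) by rewrite XY mulNr -mulrA XY mulrN opprK.
rewrite -mulrA Y2 mulrA Y2 mulrBr mulrDr mulrBl mulrDl mulr1 mul1r.
move/addIr; rewrite XY => /eqP; rewrite -opprD eq_sym -addr_eq0.
have -> : Y * X = Y *m X by rewrite mulmxE.
rewrite -!mulr2n -mulrnA -scaler_nat scaler_eq0 => /orP[].
  by rewrite (natrM _ 2 2) mulf_eq0 orbb (negPf two).
move/eqP=> YX0; have := unitmx_mul Y X; rewrite YX0 uX uY.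
by rewrite unitmxE det0 ?unitr0.
Qed.

End U2.

(** * The derived subgroup and additive characters *)

Section Derived.
Variables (gT : finGroupType) (G : {group gT}).

(** Elements of the derived subgroup can thus be found by comparing [x * y] with [y * x], without
    computing inverses. *)
Lemma der1_commg (x y : gT) : x \in G -> y \in G ->
  exists2 z, z \in G^`(1)%g & (x * y = y * x * z)%g.
Proof. by exists [~ x, y]%g; [apply: mem_commg | apply: commgC]. Qed.

(** The target is abelian, so the kernel contains all commutators. As [f] is additive on [G] only,
    this kernel is built by hand inside [G]. *)
Lemma additive_der1 (V : zmodType) (f : gT -> V) :
  {in G &, forall x y, f (x * y)%g = f x + f y}%R ->
  forall x, x \in G^`(1)%g -> f x = 0%R.
Proof.
move=> fM.
have kerG : group_set [set x in G | f x == 0%R].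
  apply/group_setP; split=> [|x y].
    rewrite inE group1 /=; apply/eqP/(@addrI _ (f 1%g)).
    by rewrite -fM // mulg1 addr0.
  rewrite !inE => /andP[xG /eqP x0] /andP[yG /eqP y0].
  by rewrite groupM // fM // x0 y0 addr0 eqxx.
suff /subsetP sub : G^`(1)%g \subset Group kerG.
  by move=> x /sub; rewrite inE => /andP[_ /eqP].
rewrite gen_subG; apply/subsetP=> _ /imset2P[x y xG yG ->].
have := fM _ _ (groupM yG xG) (groupR xG yG).
rewrite -commgC (fM x y) // (fM y x) // addrC -[LHS]addr0 => /addrI fR.
by rewrite inE groupR //= -fR.
Qed.

End Derived.

(** * Additivity and zeros of [theta] *)

Section Theta.
Local Open Scope ring_scope.

Definition theta (R : comPzRingType) (a b c d : R) : R :=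
  (1 - c ^+ 2) * b * d + c * (a + d - 3%:R).

Definition theta_defect (R : comPzRingType) (a b c d a' b' c' d' : R) : R :=
  theta (a * a' + b * c') (a * b' + b * d') (c * a' + d * c') (c * b' + d * d')
  - (theta a b c d + theta a' b' c' d').

(** Representatives of all classes modulo 2 and modulo 3; modulo 2 the classes of 1 and -1 coincide,
    which is harmless. *)
Definition trits : seq int := [:: 0; 1; -1].

Definition all_SL2_trits (p : nat) (P : int -> int -> int -> int -> bool) :=
  all (fun a => all (fun b => all (fun c => all (fun d =>
    (p %| a * d - b * c - 1)%Z ==> P a b c d) trits) trits) trits) trits.

Definition theta_mul_check (p : nat) :=
  all_SL2_trits p (fun a b c d => all_SL2_trits p (fun a' b' c' d' =>
    (p %| theta_defect a b c d a' b' c' d')%Z)).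

(** Additivity is not a polynomial identity, so it is checked exhaustively, over [int] because an
    abstract field does not compute. *)
Lemma theta_mul_check23 (p : nat) : p = 2 \/ p = 3 -> theta_mul_check p.
Proof. by case=> ->; vm_compute. Qed.

(** The defect is a polynomial with integer coefficients; this carries the integer check over to
    [F]. *)
Lemma theta_defect_intr (R : comNzRingType) (a b c d a' b' c' d' : int) :
  (theta_defect a b c d a' b' c' d')%:~R =
  theta_defect (a%:~R : R) b%:~R c%:~R d%:~R a'%:~R b'%:~R c'%:~R d'%:~R.
Proof. by rewrite /theta_defect /theta; ring. Qed.

Variables (F : finFieldType) (F_le3 : (#|F| <= 3)%N).

Lemma card_le3 : #|F| = 2 \/ #|F| = 3.
Proof.
by have := finNzRing_gt1 F; move: F_le3; case: #|F| => [|[|[|[|]]]]; auto.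
Qed.

Lemma pchar_card_le3 : #|F| \in [pchar F].
Proof.
by case: card_le3 => cF; rewrite [X in X \in _]cF;
  apply: (@card_finPcharP F _ 1); rewrite ?cF.
Qed.

(** Both orders give [x^3 = x], since [x^2 = x] implies it; then [x^3 - x] is factored. *)
Lemma card_le3_cases (x : F) : [\/ x = 0, x = 1 | x = -1].
Proof.
have /eqP : x ^+ 3 - x = 0.
  have := expf_card x; case: card_le3 => -> e; apply/eqP; rewrite subr_eq0.
    by rewrite exprS e -expr2 e.
  by rewrite e.
have -> : x ^+ 3 - x = x * ((x - 1) * (x + 1)) by ring.
rewrite !mulf_eq0 subr_eq0 addr_eq0.
by case/or3P=> /eqP; [constructor 1 | constructor 2 | constructor 3].
Qed.

Lemma tritP (x : F) : exists2 z, z \in trits & x = z%:~R.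
Proof.
by case: (card_le3_cases x) => ->; [exists 0|exists 1|exists (-1)];
  rewrite ?rmorphN.
Qed.

Lemma theta_mul (a b c d a' b' c' d' : F) :
  a * d - b * c = 1 -> a' * d' - b' * c' = 1 ->
  theta (a * a' + b * c') (a * b' + b * d') (c * a' + d * c') (c * b' + d * d')
  = theta a b c d + theta a' b' c' d'.
Proof.
have chk : theta_mul_check #|F| := theta_mul_check23 card_le3.
(* The order of [F] is its characteristic, so congruences between integer lifts are equations in
   [F]. *)
have dvdP (z : int) : (#|F| %| z)%Z = (z%:~R == 0 :> F).
  by rewrite (dvdz_pcharf pchar_card_le3).
case: (tritP a) (tritP b) (tritP c) (tritP d)
  => [ai ia ->] [bi ib ->] [ci ic ->] [di id ->].
case: (tritP a') (tritP b') (tritP c') (tritP d')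
  => [ai' ia' ->] [bi' ib' ->] [ci' ic' ->] [di' id' ->].
move=> e e'; apply/eqP; rewrite -subr_eq0 -/(theta_defect _ _ _ _ _ _ _ _).
rewrite -theta_defect_intr -dvdP.
move/allP: chk => /(_ _ ia) /allP /(_ _ ib) /allP /(_ _ ic) /allP /(_ _ id).
have d1 : (#|F| %| ai * di - bi * ci - 1)%Z.
  by rewrite dvdP !(rmorphB, rmorphM) /= e subrr.
have d2 : (#|F| %| ai' * di' - bi' * ci' - 1)%Z.
  by rewrite dvdP !(rmorphB, rmorphM) /= e' subrr.
move/implyP/(_ d1)/allP=> /(_ _ ia') /allP /(_ _ ib') /allP /(_ _ ic').
by move/allP=> /(_ _ id') /implyP; apply.
Qed.

Lemma theta_eq0 (a b c d : F) :
  a * d - b * c = 1 -> theta a b c d = 0 ->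
  [\/ mx2 a b c d = 1%:M, mx2 a b c d = - 1%:M | c != 0 /\ a + d = 3%:R].
Proof.
(* For [c = 0], [theta] is [b * d] with [d] invertible, so [b = 0] and [a = d] is 1 or -1. *)
rewrite /theta; have [->|c0] := eqVneq c 0.
  rewrite mulr0 subr0 expr0n subr0 mul1r mul0r addr0 => ad /eqP.
  have d0 : d != 0.
    by apply: contra_eq_neq ad => ->; rewrite mulr0 eq_sym oner_eq0.
  rewrite mulf_eq0 (negPf d0) orbF => /eqP ->.
  case: (card_le3_cases d) d0 ad => -> d0;
    rewrite ?mulr1 ?mulrN1 ?eqxx // in d0 * => ad.
    by constructor 1; rewrite mx2_scalar ad.
  constructor 2; rewrite mx2_scalar -[a]opprK ad.
  by apply: matrix2P; split; rewrite !mxE ?oppr0.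
move=> _ e; constructor 3; split=> //.
(* The first term of [theta] now disappears, leaving [c * (a + d - 3) = 0]. *)
have c2 : c ^+ 2 = 1.
  by case: (card_le3_cases c) c0 => ->; rewrite ?eqxx ?sqrrN ?expr1n.
move/eqP: e; rewrite c2 subrr !mul0r add0r mulf_eq0 (negPf c0) subr_eq0.
by move/eqP.
Qed.

(** * [theta] as a character of the group, and -1 as an element of the derived subgroup *)

Definition thetaM (A : 'M[F]_2) := theta (A 0 0) (A 0 1) (A 1 0) (A 1 1).

Lemma thetaM_mx2 (a b c d : F) : thetaM (mx2 a b c d) = theta a b c d.
Proof. by rewrite /thetaM !mxE. Qed.

Lemma thetaM_mul (A B : 'M[F]_2) : \det A = 1 -> \det B = 1 ->
  thetaM (A *m B) = thetaM A + thetaM B.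
Proof.
rewrite (mx2_eta A) (mx2_eta B) !det_mx2 mx2_mul !thetaM_mx2.
exact: theta_mul.
Qed.

Lemma SL2P (g : {'GL_2[F]}) : reflect (\det (GLval g) = 1) (g \in SL2 F).
Proof. by rewrite inE; apply: eqP. Qed.

Lemma thetaM_SL2 : {in SL2 F &, forall g h : {'GL_2[F]},
  thetaM (GLval (g * h)%g) = thetaM (GLval g) + thetaM (GLval h)}.
Proof. by move=> g h /SL2P dg /SL2P dh; rewrite GL_MxE thetaM_mul. Qed.

Lemma theta_der1 (g : {'GL_2[F]}) :
  g \in (SL2 F)^`(1)%g -> thetaM (GLval g) = 0.
Proof. exact: (@additive_der1 _ (SL2_group F) F _ thetaM_SL2). Qed.

Lemma SL2_lift (A : 'M[F]_2) : \det A = 1 ->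
  exists2 g : {'GL_2[F]}, g \in SL2 F & GLval g = A.
Proof.
move=> dA; have uA : A \is a GRing.unit.
  by rewrite -[_ \is a _]/(A \in unitmx) unitmxE dA unitr1.
by exists (FinRing.unit _ uA) => //; apply/SL2P.
Qed.

Lemma opp1_der1 : #|F| = 3 ->
  exists2 g : {'GL_2[F]}, g \in (SL2 F)^`(1)%g & GLval g = - 1%:M.
Proof.
move=> cF; have := pchar_card_le3; rewrite [X in X \in _]cF => /andP[_ /eqP c3].
(* [i] and [j] generate a quaternion group: [i j = - j i]. The determinant of [j] is -2, which is 1
   in characteristic 3. *)
have [|i iS ei] := @SL2_lift (mx2 0 (-1) 1 0); first by rewrite det_mx2; ring.
have [|j jS ej] := @SL2_lift (mx2 1 1 1 (-1)).
  by rewrite det_mx2; apply: subr0_eq; rewrite -[RHS]oppr0 -c3; ring.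
have [z zD eij] := der1_commg (G := SL2_group F) iS jS.
exists z => //; move: (congr1 (@GLval 2 F) eij).
rewrite !GL_MxE ei ej => e; apply: (can_inj (mulKmx (GL_unit (j * i)%g))).
rewrite GL_MxE ei ej -e !mx2_mul mulmxN mulmx1.
by apply: matrix2P; split; rewrite !mxE /=; ring.
Qed.

End Theta.

Theorem theorem3p9 (F : finFieldType) (hF : #|F| <= 3) :
  [/\ (forall g : {'GL_2[F]}, g \in (SL2 F)^`(1)%g ->
         prod_at_most_U2_commutators #|F|.-1 (GLval g)),
      (forall r : nat, r < #|F|.-1 ->
         exists2 g : {'GL_2[F]}, g \in (SL2 F)^`(1)%g &
           ~ prod_at_most_U2_commutators r (GLval g))
    & (SL2 F)^`(1)%g \proper SL2 F].
Proof.
have F_gt1 := finNzRing_gt1 F; split.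
- move=> g gD; have /SL2P := subsetP (der_sub 1 _) _ gD.
  move/(theta_der1 hF): gD; rewrite (mx2_eta (GLval g)) det_mx2 thetaM_mx2.
  move=> th0 dg; case: (theta_eq0 hF dg th0) => [->|->|[c0 tr]].
  + exists [:: 1%:M]%R; rewrite big_seq1; split=> //= [|C].
      by case: #|F| F_gt1 => [|[]].
    by rewrite inE => /eqP ->; apply: U2_commutator1.
  + case: (card_le3 hF) => cF.
      (* In characteristic 2, -1 is 1, so one factor is enough. *)
      exists [:: 1%:M]%R; rewrite big_seq1 cF; split=> //= [C|].
        by rewrite inE => /eqP ->; apply: U2_commutator1.
      have := pchar_card_le3 hF; rewrite [X in X \in _]cF => c2.
      by rewrite mx2_scalar; apply: matrix2P; split;
        rewrite !mxE ?oppr0 ?(oppr_pchar2 c2).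
    pose J := mx2 0%R (-1)%R 1%R (0 : F)%R.
    exists [:: J; J]; rewrite big_cons big_seq1 cF; split=> //= [C|].
      rewrite !inE orbb => /eqP ->; apply: trace3_U2_commutator.
      * exact: oner_neq0.
      * by ring.
      * have := pchar_card_le3 hF; rewrite [X in X \in _]cF addr0.
        by case/andP=> _ /eqP ->.
    rewrite -mulmxE mx2_mul mx2_scalar.
    by apply: matrix2P; split; rewrite !mxE /=; ring.
  + exists [:: mx2 (GLval g 0 0) (GLval g 0 1) (GLval g 1 0) (GLval g 1 1)]%R.
    rewrite big_seq1; split=> //= [|C]; first by case: #|F| F_gt1 => [|[]].
    by rewrite inE => /eqP ->; apply: trace3_U2_commutator.
- move=> r; case: (card_le3 hF) => cF; rewrite cF /=.
    (* Here [r = 0], and no sequence has length between 1 and 0, so even the identity is a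
       witness. *)
    case: r => // _; exists 1%g; first exact: group1.
    by case=> s [/andP[s_gt0]]; rewrite leqNgt s_gt0.
  (* Here [r] is at most 1, so a product equal to -1 would be a single commutator. *)
  move=> r_lt2; have [g gD eg] := opp1_der1 hF cF; exists g => //.
  have c3 := pchar_card_le3 hF; rewrite [X in X \in _]cF in c3.
  rewrite eg => -[[|C [|C' s]] [/andP[_ sr] UC]] //; last first.
    by have := leq_ltn_trans sr r_lt2.
  rewrite big_seq1 => eC; apply: (@opp1_not_U2_commutator F).
    by rewrite -(dvdn_pcharf c3).
  by rewrite eC; apply: UC; rewrite inE.
- apply/properP; split; first exact: der_sub.
  have [|g gS eg] := @SL2_lift F (mx2 1 1 0 1)%R; first by rewrite det_mx2; ring.
  exists g => //; apply/negP => /(theta_der1 hF); rewrite eg thetaM_mx2 /theta.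
  by apply/eqP; rewrite expr0n /= subr0 !mulr1 mul0r addr0 oner_eq0.
Qed.
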